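(* Let $(m,m_1,m_2)$ be a Markoff triple and let $f_m(x,y)=mx^2+(3m-2u)xy+(v-3u)y^2$ be the Markoff form associated to it. If a real number $\theta$ is $\pm$ equivalent to a root of $f_m(x,1)=0$, then \[ m\,\|m\theta\| = \frac{2}{3+\sqrt{9-4m^{-2}}}, \] and \[ q\,\|q\theta\| > m\,\|m\theta\| \quad\text{for every } q\in\mathbb{N},\ q\neq m . \]
   Context: A Markoff triple is a triple of integers $(m,m_1,m_2)$ with $m\ge m_1\ge m_2\ge 1$ and $m^2+m_1^2+m_2^2=3mm_1m_2$. The Markoff form associated to it is $f_m(x,y)=mx^2+(3m-2u)xy+(v-3u)y^2$, where $u$ is the least positive solution of $\pm m_2x\equiv m_1 \pmod m$ and $v=(u^2+1)/m$ (an integer). For real $x$, $\|x\|=\min\{|x-p|:p\in\mathbb{Z}\}$. Two real numbers are $\pm$ equivalent if their sum or their difference is an integer. *)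

(* Defs.v *)
From HB Require Import structures.
From mathcomp Require Import all_boot all_order all_algebra.
From mathcomp Require Import all_classical all_reals.
Set Implicit Arguments.
Unset Strict Implicit.
Unset Printing Implicit Defensive.
Import Order.TTheory GRing.Theory Num.Theory.
Local Open Scope classical_set_scope.
Local Open Scope ring_scope.

Definition markoff_triple (m m1 m2 : int) : Prop :=
  [/\ m1 <= m, m2 <= m1, 1 <= m2 &
      m ^+ 2 + m1 ^+ 2 + m2 ^+ 2 = 3 * m * m1 * m2].

Definition markoff_congr (m m1 m2 x : int) : Prop :=
  (m2 * x = m1 %[mod m])%Z \/ (- m2 * x = m1 %[mod m])%Z.

Definition is_least_pos (P : int -> Prop) (u : int) : Prop :=
  [/\ 0 < u, P u & forall w : int, 0 < w -> P w -> u <= w].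

(* The default value 0 is never used for a Markoff triple: its members are
   pairwise coprime, so the congruence is solvable. *)
Definition markoff_u (m m1 m2 : int) : int :=
  xget 0 [set u | is_least_pos (markoff_congr m m1 m2) u].

Section Reals.
Context {R : realType}.

(* For a Markoff triple m divides u ^ 2 + 1; the quotient is taken in R, so
   that v is exact without a divisibility proof. *)
Definition markoff_v (m m1 m2 : int) : R :=
  ((markoff_u m m1 m2)%:~R ^+ 2 + 1) / m%:~R.

Definition markoff_form (m m1 m2 : int) (x y : R) : R :=
  let u : R := (markoff_u m m1 m2)%:~R in
  let v : R := markoff_v m m1 m2 in
  m%:~R * x ^+ 2 + (3 * m%:~R - 2 * u) * x * y + (v - 3 * u) * y ^+ 2.

(* The infimum is a minimum: see [dist_int_min]. *)
Definition dist_int (x : R) : R := inf [set `|x - p%:~R| | p in [set: int]].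

Definition pm_equiv (x y : R) : Prop :=
  x + y \is a Num.int \/ x - y \is a Num.int.

Lemma dist_int_min (x : R) :
  (exists p : int, dist_int x = `|x - p%:~R|) /\
  (forall p : int, dist_int x <= `|x - p%:~R|).
Proof.
set A := [set `|x - p%:~R| | p in [set: int]].
have lbA : has_lbound A by exists 0 => _ [p _ <-].
have le_inf p : dist_int x <= `|x - p%:~R|.
  by apply: ge_inf => //; exists p.
split=> //.
pose f := Num.floor x.
have fx : f%:~R <= x := floor_le x.
have xf : x < (f + 1)%:~R := floorD1_gt x.
pose d : R := Num.min `|x - f%:~R| `|x - (f + 1)%:~R|.
have d_lb : d <= dist_int x.
  apply: lb_le_inf; first by exists `|x - f%:~R|, f.
  move=> _ [p _ <-]; rewrite ge_min.
  have [pf|fp] := leP p f.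
    apply/orP; left; have pf' : p%:~R <= f%:~R :> R by rewrite ler_int.
    rewrite !ger0_norm ?subr_ge0 ?(le_trans pf') //.
    by rewrite lerD2l lerN2.
  apply/orP; right.
  have fp' : (f + 1)%:~R <= p%:~R :> R by rewrite ler_int lezD1.
  rewrite !ler0_norm ?subr_le0 ?(le_trans (ltW xf)) //.
  by rewrite !opprB lerD2r.
have [le1|/ltW le2] := leP `|x - f%:~R| `|x - (f + 1)%:~R|.
  by exists f; apply/eqP; rewrite eq_le le_inf /= -(min_idPl le1).
exists (f + 1); apply/eqP; rewrite eq_le le_inf /=.
by move: d_lb; rewrite /d (min_idPr le2).
Qed.

End Reals.

(* Main.v *)
Require Import Defs.
From HB Require Import structures.
From mathcomp Require Import all_boot all_order all_algebra.
From mathcomp Require Import all_classical all_reals.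
From mathcomp Require Import zify ring lra.
Import Order.TTheory GRing.Theory Num.Theory.
Local Open Scope ring_scope.

(* Let e be the small root of e^2 - 3me + 1. If theta is +- equivalent to a root
   of f_m(x,1), then m theta = k -+ e with k = +-u mod m, so that
   m |q theta - p| = |a + e q| for an integer a = +-kq mod m. Such pairs (a,q)
   satisfy a m2 = +-q m1 mod m, a condition that cuts out (up to sign) a lattice
   stable under the automorphs (a,b) -> (3mb - a, b) of a^2 + b^2 - 3mab.
   Everything reduces to the inequality a^2 + b^2 + m^2 <= 3mab for the pairs of
   this lattice with 0 < a, b < m. It is proved by induction along the Markoff
   tree: if a m2 - b m1 = t m with t >= 0, the pair (b,t) satisfies the
   corresponding congruence modulo m2, and
     m2^2 (3mab - a^2 - b^2 - m^2) = m^2 (b^2 + 3 m2 b t - t^2 - m2^2) - 2 m m1 b t. *)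

(** * Unordered Markoff solutions, Vieta descent and tree induction *)

(** No order is imposed on the entries, so that permutations and Vieta reflections stay inside the
    predicate. *)
Definition markoff_sol (x y z : int) : Prop :=
  [/\ 0 < x, 0 < y, 0 < z & x * x + y * y + z * z = 3 * x * y * z].

Lemma markoff_sol_swap x y z : markoff_sol x y z -> markoff_sol y x z.
Proof. by case=> *; split=> //; lia. Qed.

Lemma markoff_sol_rot x y z : markoff_sol x y z -> markoff_sol y z x.
Proof. by case=> *; split=> //; lia. Qed.

(** The reflected entry [w] is the other root of the quadratic in [x], so [x * w = y ^ 2 + z ^ 2]
    makes it positive. If [x <= w], both roots are at least [y], and the value of the quadratic at
    [y] forces [y = z = 1], hence [x = 1]. *)
Lemma markoff_sol_descent x y z :
  markoff_sol x y z -> y <= x -> z <= x -> 1 < x ->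
  markoff_sol (3 * y * z - x) y z /\ 3 * y * z - x < x.
Proof.
wlog zy : y z / z <= y => [hw|].
  case: (leP z y) => [|/ltW] yz hs yx zx x1; first exact: hw.
  have [] := hw z y yz (markoff_sol_rot _ _ _ (markoff_sol_swap _ _ _ hs)) zx yx x1.
  have -> : 3 * z * y = 3 * y * z by ring.
  by move=> [? ? ? ?] ?; split=> //; split=> //; lia.
case=> x0 y0 z0 e yx zx x1.
pose w := 3 * y * z - x; rewrite -/w.
have exw : x * w = y * y + z * z by rewrite /w; lia.
have w0 : 0 < w by nia.
split; first by split=> //; rewrite /w; lia.
rewrite ltNge; apply/negP => xw.
have h : (x - y) * (w - y) = 2 * (y * y) + z * z - 3 * z * (y * y).
  by rewrite /w; lia.
have h0 : 0 <= (x - y) * (w - y) by apply: mulr_ge0; lia.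
have z1 : z = 1 by nia.
have y1 : y = 1 by subst z; nia.
by subst y z; nia.
Qed.

(** For a permutation-invariant [P] the largest entry may be put first; the descent then lowers the
    sum of the entries until (1, 1, 1) is reached. *)
Lemma markoff_ind (P : int -> int -> int -> Prop) :
  (forall x y z, P x y z -> P y x z) ->
  (forall x y z, P x y z -> P y z x) ->
  P 1 1 1 ->
  (forall x y z, markoff_sol x y z -> y <= x -> z <= x -> 1 < x ->
     P (3 * y * z - x) y z -> P x y z) ->
  forall x y z, markoff_sol x y z -> P x y z.
Proof.
move=> Pswap Prot P1 Pstep x y z hs.
have [n] := ubnP (absz (x + y + z)).
elim: n x y z hs => // n IHn x y z hs.
wlog [yx zx] : x y z hs / y <= x /\ z <= x => [hw hn|].
  have [yx|xy] := leP y x; have [zx|xz] := leP z x.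
  - exact: hw.
  - apply: (Prot z x y); apply: hw; [|lia|lia].
    exact/markoff_sol_rot/markoff_sol_rot.
  - apply/Prot/Prot; apply: hw; [|lia|lia].
    exact: markoff_sol_rot.
  - have [zy|yz] := leP z y.
      apply/Prot/Prot; apply: hw; [exact: markoff_sol_rot|lia|lia].
    apply: (Prot z x y); apply: hw; [|lia|lia].
    exact/markoff_sol_rot/markoff_sol_rot.
move=> hn; have [x1|x1] := leP x 1.
  have [x0 y0 z0 e] := hs.
  have -> : x = 1 by lia.
  have -> : y = 1 by lia.
  by have -> : z = 1 by lia.
have [hs' lt] := markoff_sol_descent x y z hs yx zx x1.
apply: Pstep => //; apply: IHn => //.
by have [? ? ? _] := hs'; have [? ? ? _] := hs; lia.
Qed.

(** * The key inequality inside the square of side x *)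

Definition markoff_bound (x y z : int) : Prop :=
  forall a b : int, 0 < a < x -> 0 < b < x -> (x %| a * z - b * y)%Z ->
  a * a + b * b + x * x <= 3 * x * a * b.

Lemma markoff_bound_sym x y z : markoff_bound x y z -> markoff_bound x z y.
Proof.
move=> h a b ha hb hd.
have -> : a * a + b * b + x * x = b * b + a * a + x * x by ring.
have -> : 3 * x * a * b = 3 * x * b * a by ring.
by apply: h => //; rewrite -opprB rpredN.
Qed.

(** Modulo [x] one has [y ^ 2 = - z ^ 2], so multiplying the hypothesis by [y] gives [z] times the
    conclusion, and [z] can be cancelled. *)
Lemma bound_flip_sign x y z a b : markoff_sol x y z -> coprimez x z ->
  (x %| a * z + b * y)%Z -> (x %| a * y - b * z)%Z.
Proof.
move=> [x0 y0 z0 e] cop /dvdzP [k hk].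
rewrite -(Gauss_dvdzr _ cop); apply/dvdzP.
exists (y * k + b * (x - 3 * y * z)).
rewrite mulrDl -mulrA -hk.
have : b * (x * x + y * y + z * z - 3 * x * y * z) = 0 by rewrite e subrr mulr0.
by lia.
Qed.

(** Two smaller moduli occur because of the sign of t: t >= 0 leads to the modulus [z], t < 0 to the
    modulus [y]. *)
Lemma markoff_bound_max x y z : markoff_sol x y z -> y <= x -> z <= x ->
  coprimez y z ->
  markoff_bound z (3 * y * z - x) y -> markoff_bound y (3 * y * z - x) z ->
  markoff_bound x y z.
Proof.
move=> hs yx zx cop hz hy a b ha hb /dvdzP [t ht].
(* Exchanging [a] with [b] and [y] with [z] negates [t]. *)
wlog t0 : y z a b t hs yx zx cop hz hy ha hb ht / 0 <= t => [hw|].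
  have [|t0] := leP 0 t; first exact: hw hz hy ha hb ht.
  have -> : a * a + b * b + x * x = b * b + a * a + x * x by ring.
  have -> : 3 * x * a * b = 3 * x * b * a by ring.
  have e : 3 * z * y - x = 3 * y * z - x by ring.
  apply: (hw z y b a (- t)) => //; rewrite ?e //; try lia.
    exact/markoff_sol_rot/markoff_sol_swap.
  by rewrite coprimez_sym.
have [x0 y0 z0 e] := hs.
have [a0 ax] := andP ha; have [b0 bx] := andP hb.
have az : 0 < (x - a) * z by rewrite mulr_gt0 ?subr_gt0.
have by0 : 0 < b * y by rewrite mulr_gt0.
have tz : t < z by rewrite -(ltr_pM2r x0); lia.
(* This uses 2a <= 3xb, which follows from a < x. *)
have bt : t * y <= b * x.
  rewrite -(ler_pM2r x0).
  have h1 : 2 * (t * y * x) <= 2 * (b * x * x).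
    have -> : 2 * (t * y * x) = 2 * y * (t * x) by ring.
    rewrite -ht.
    have h2 : 0 <= y * z * (3 * x * b - 2 * a).
      have : 0 <= x * (b - 1) by apply: mulr_ge0; lia.
      by move=> ?; apply: mulr_ge0; [apply: mulr_ge0|]; lia.
    have h3 : 0 <= b * ((x - z) * (x + z)) by apply: mulr_ge0; [lia|apply: mulr_ge0; lia].
    have h4 : 0 < b * (y * y) by rewrite !mulr_gt0.
    have : b * (x * x + y * y + z * z - 3 * x * y * z) = 0 by rewrite e subrr mulr0.
    lia.
  lia.
have key : z * z * (3 * x * a * b - (a * a + b * b + x * x)) =
    x * (x * (b * b + 3 * z * b * t - t * t - z * z) - 2 * b * t * y).
  have ea : a * z = b * y + t * x by lia.
  have e2 : z * z * (3 * x * a * b - (a * a + b * b + x * x)) =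
    3 * x * z * b * (a * z) - (a * z) * (a * z) - z * z * (b * b + x * x) by ring.
  rewrite e2 ea.
  have : b * b * (x * x + y * y + z * z - 3 * x * y * z) = 0 by rewrite e subrr mulr0.
  lia.
rewrite -subr_ge0 -(@pmulr_rge0 _ (z * z)) ?mulr_gt0 // key.
apply: mulr_ge0; first exact: ltW.
have x_ge0 : 0 <= x by exact: ltW.
(* For [t = 0] coprimality gives [z %| b], so [b >= z] and the bracket is [x * (b ^ 2 - z ^ 2)]. *)
have [t_eq0|tn0] := eqVneq t 0.
  have /dvdzP [k hk] : (z %| b)%Z.
    rewrite -(@Gauss_dvdzr z y b); last by rewrite coprimez_sym.
    by apply/dvdzP; exists a; rewrite t_eq0 in ht; lia.
  have k0 : 0 < k by rewrite -(pmulr_lgt0 _ z0) -hk.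
  have bz : z <= b by rewrite hk ler_peMl //; lia.
  have h : 0 <= b * b - z * z by rewrite -!expr2 subr_sqr mulr_ge0 //; lia.
  have := mulr_ge0 x_ge0 h; rewrite t_eq0; lia.
have tp : 0 < t by lia.
(* For [b < z] the pair ([b], [t]) falls under [hz], and [bt] accounts for the rest; for
   [b >= z > t] every summand of the regrouped bracket is nonnegative. *)
have [bz|zb] := ltP b z.
  have h : b * b + t * t + z * z <= 3 * z * b * t.
    apply: hz; [lia|lia|].
    by apply/dvdzP; exists (a - 3 * y * t); lia.
  have h1 : 0 <= x * (3 * z * b * t - (b * b + t * t + z * z)).
    by apply: mulr_ge0; lia.
  have h2 : 0 <= 2 * (b * (b * x - t * y)).
    by rewrite mulr_ge0 // mulr_ge0 ?subr_ge0 // ltW.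
  rewrite (_ : _ - _ = x * (3 * z * b * t - (b * b + t * t + z * z)) +
    2 * (b * (b * x - t * y))); last by ring.
  exact: addr_ge0.
have bt0 : 0 < b * t by rewrite mulr_gt0.
have h1 : 0 <= b * b - z * z by rewrite -!expr2 subr_sqr mulr_ge0 //; lia.
have h2 : 0 <= b * t - t * t by rewrite -mulrBl mulr_ge0 //; lia.
have h3 : 0 <= (b * t) * (z - 1) by apply: mulr_ge0; lia.
rewrite (_ : _ - _ = x * ((b * b - z * z) + (b * t - t * t) +
  3 * ((b * t) * (z - 1))) + 2 * ((b * t) * (x - y))); last by ring.
apply: addr_ge0.
  by apply: mulr_ge0 => //; apply: addr_ge0; [exact: addr_ge0|exact: mulr_ge0].
by rewrite mulr_ge0 // mulr_ge0 ?subr_ge0 // ltW.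
Qed.

(** Modulo [y] the reflection replaces [x] by [- x]; [bound_flip_sign] absorbs this sign. *)
Lemma markoff_bound_reflect x y z : markoff_sol (3 * y * z - x) y z ->
  coprimez y z -> markoff_bound y (3 * y * z - x) z -> markoff_bound y z x.
Proof.
move=> hs cyz hb; apply: markoff_bound_sym => a b ha hb' /dvdzP [k hk].
have -> : a * a + b * b + y * y = b * b + a * a + y * y by ring.
have -> : 3 * y * a * b = 3 * y * b * a by ring.
apply: hb => //.
rewrite -opprB rpredN; apply: bound_flip_sign => //.
  exact: markoff_sol_swap.
by apply/dvdzP; exists (k + 3 * b * z); lia.
Qed.

Lemma coprimez_reflect x y z :
  coprimez (3 * y * z - x) y = coprimez x y.
Proof.
rewrite coprimez_sym /coprimez (_ : _ - _ = 3 * z * y + (- x)); last by ring.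
by rewrite gcdzMDl gcdzN gcdzC.
Qed.

(** Coprimality and the bounds for all three moduli are carried together, since the bound at the new
    largest entry consumes the others. *)
Lemma markoff_coprime_bound x y z : markoff_sol x y z ->
  [/\ coprimez x y, coprimez y z & coprimez z x] /\
  [/\ markoff_bound x y z, markoff_bound y z x & markoff_bound z x y].
Proof.
move: x y z; apply: markoff_ind.
- move=> x y z [[cxy cyz czx] [bx by' bz]]; split; split;
    by [rewrite coprimez_sym | exact: markoff_bound_sym].
- by move=> x y z [[? ? ?] [? ? ?]].
- by split; split=> // a b; lia.
move=> x y z hs yx zx x1 [[cxy cyz czx] [_ by' bz]].
have [hs0 _] := markoff_sol_descent _ _ _ hs yx zx x1.
have e : 3 * y * z = 3 * z * y by ring.
split; split=> //.
- by rewrite coprimez_reflect in cxy.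
- by rewrite coprimez_sym e coprimez_reflect coprimez_sym in czx.
- by apply: markoff_bound_max => //; exact: markoff_bound_sym.
- by apply: markoff_bound_reflect => //; exact: markoff_bound_sym.
- apply: markoff_bound_sym; apply: markoff_bound_reflect; rewrite -?e //.
    exact/markoff_sol_rot/markoff_sol_swap.
  by rewrite coprimez_sym.
Qed.

(** * The lattice and the minimum of the form on it *)

(* Since x %| y ^ 2 + z ^ 2 and x is coprime to z, swapping a and b exchanges the two signs. *)
Definition markoff_lattice (x y z a b : int) : Prop :=
  (x %| a * z - b * y)%Z \/ (x %| a * z + b * y)%Z.

Lemma markoff_lattice_opp x y z a b :
  markoff_lattice x y z a b -> markoff_lattice x y z (- a) b.
Proof.
by case=> h; [right|left]; rewrite -rpredN; move: h;
  congr (_ %| _)%Z; ring.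
Qed.

Lemma markoff_lattice_swap x y z a b : markoff_sol x y z ->
  markoff_lattice x y z a b -> markoff_lattice x y z b a.
Proof.
move=> hs; have [[_ _ czx] _] := markoff_coprime_bound _ _ _ hs.
rewrite coprimez_sym in czx; case=> h; [right|left].
  have := bound_flip_sign _ _ _ a (- b) hs czx.
  by rewrite !mulNr opprK [b * z + _]addrC; exact.
by rewrite -opprB rpredN; exact: bound_flip_sign.
Qed.

Lemma markoff_lattice_jump x y z a b :
  markoff_lattice x y z a b -> markoff_lattice x y z (3 * x * b - a) b.
Proof.
case=> /dvdzP [k hk]; [right|left]; apply/dvdzP; exists (3 * b * z - k); lia.
Qed.

Lemma markoff_lattice_bound x y z a b : markoff_sol x y z ->
  markoff_lattice x y z a b -> 0 < a < x -> 0 < b < x ->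
  a * a + b * b + x * x <= 3 * x * a * b.
Proof.
move=> hs; have [[_ _ czx] [h _ _]] := markoff_coprime_bound _ _ _ hs.
case=> hd ha hb; first exact: h.
have -> : a * a + b * b + x * x = b * b + a * a + x * x by ring.
have -> : 3 * x * a * b = 3 * x * b * a by ring.
apply: h => //; rewrite -opprB rpredN; apply: bound_flip_sign => //.
by rewrite coprimez_sym.
Qed.

Lemma markoff_lattice_axis x y z a : markoff_sol x y z ->
  markoff_lattice x y z a 0 -> (x %| a)%Z.
Proof.
move=> hs; have [[_ _ czx] _] := markoff_coprime_bound _ _ _ hs.
rewrite coprimez_sym in czx.
by case; rewrite mul0r ?subr0 ?addr0 Gauss_dvdzl.
Qed.

(** Reduction by automorphs: with [b <= a], the larger coordinate is replaced by [3 * x * b - a] as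
    long as this decreases it. A reduced pair lies on an axis, lies in the square of side [x], or
    has a value that is directly large. *)
Lemma markoff_form_min x y z a b : markoff_sol x y z ->
  markoff_lattice x y z a b -> 0 <= a -> 0 <= b -> 0 < a + b ->
  x * x <= `|a * a + b * b - 3 * x * a * b|.
Proof.
move=> hs; have [x0 _ _ _] := hs.
have [n] := ubnP (absz (a + b)); elim: n a b => // n IHn a b.
wlog ba : a b / b <= a => [hw|].
  have [|/ltW ab] := leP b a; first exact: hw.
  move=> hn hl a0 b0 ab0.
  have -> : a * a + b * b - 3 * x * a * b = b * b + a * a - 3 * x * b * a by ring.
  by apply: hw => //; [lia|exact: markoff_lattice_swap|lia].
move=> hn hl _ b0 ab0.
have a0 : 0 < a by lia.
have [b_eq0|bn0] := eqVneq b 0.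
  move: hl; rewrite b_eq0 => /(markoff_lattice_axis _ _ _ _ hs) /dvdzP [k hk].
  have k0 : 0 < k by rewrite -(pmulr_lgt0 _ x0) -hk.
  have xa : x <= a by rewrite hk ler_peMl //; lia.
  have : x * x <= a * a by rewrite ler_pM // ltW.
  lia.
have bp : 0 < b by lia.
have [ax|xa] := ltP a x.
  have := markoff_lattice_bound _ _ _ _ _ hs hl; lia.
pose a' := 3 * x * b - a.
have hl' : markoff_lattice x y z a' b := markoff_lattice_jump _ _ _ _ _ hl.
have ea' : a * a + b * b - 3 * x * a * b = a' * a' + b * b - 3 * x * a' * b.
  by rewrite /a'; ring.
have [lt|ge] := ltP a' a.
  rewrite ea'; have [a'0|a'0] := leP 0 a'.
    by apply: IHn => //; lia.
  (* With [a'] negative, all three terms of the form at ([a'], [b]) are nonnegative; a single one is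
     large enough, the product term being handled by the lattice bound for ([- a'], [b]). *)
  have hl2 := markoff_lattice_opp _ _ _ _ _ hl'.
  have h0 : 0 <= 3 * x * (- a') * b by rewrite !mulr_ge0 //; lia.
  have [xb|bx] := leP x b.
    have : x * x <= b * b by rewrite ler_pM // ltW.
    have : 0 <= a' * a' by rewrite -expr2 sqr_ge0.
    lia.
  have [xa'|ax'] := leP x (- a').
    have : x * x <= (- a') * (- a') by rewrite ler_pM // ltW.
    have : 0 <= b * b by rewrite -expr2 sqr_ge0.
    lia.
  have := markoff_lattice_bound _ _ _ _ _ hs hl2.
  have : 0 <= a' * a' by rewrite -expr2 sqr_ge0.
  have : 0 <= b * b by rewrite -expr2 sqr_ge0.
  lia.
(* Here b <= a <= a', and a * a' - b * b is the opposite of the form. *)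
suff : x * x <= a * a' - b * b by rewrite /a'; lia.
have [xb|bx] := leP x b.
  have h1 : x * x <= b * b by rewrite ler_pM // ltW.
  have h2 : 0 <= (a - b) * (a' - b) by apply: mulr_ge0; lia.
  have h3 : 0 <= (b * b) * (x - 1) by rewrite !mulr_ge0 //; lia.
  move: h2 h3; rewrite /a'; lia.
(* Both [a] and [a'] are at least [x] and their sum is [3 * x * b], so
   [a * a' >= 3 * x ^ 2 * b - x ^ 2], while [b ^ 2 < x ^ 2]. *)
have h2 : 0 <= (a - x) * (a' - x) by apply: mulr_ge0; lia.
have h3 : 0 < (x - b) * (x + b) by apply: mulr_gt0; lia.
have h4 : 0 <= (x * x) * (b - 1) by rewrite !mulr_ge0 //; lia.
move: h2 h3 h4; rewrite /a'; lia.
Qed.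

(** * The residue u and its link with the lattice *)

Lemma markoff_u_spec m m1 m2 : markoff_sol m m1 m2 ->
  is_least_pos (markoff_congr m m1 m2) (markoff_u m m1 m2).
Proof.
move=> hs; have [m0 _ _ _] := hs; have [[_ _ c] _] := markoff_coprime_bound _ _ _ hs.
have [[s t] /= st] := coprimezP _ _ c.
apply: (@xgetPex _ 0 [set u | is_least_pos (markoff_congr m m1 m2) u]).
pose P (n : nat) := (0 < n)%N && ((m2 * n%:Z == m1 %[mod m])%Z ||
  (- m2 * n%:Z == m1 %[mod m])%Z).
have PE (n : nat) : P n <-> 0 < n%:Z /\ markoff_congr m m1 m2 n%:Z.
  split=> [/andP[n0 /orP[/eqP h|/eqP h]]|[n0 h]].
  - by split=> //; left.
  - by split=> //; right.
  - by apply/andP; split=> //; apply/orP; case: h => /eqP h; [left|right].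
have exP : exists n, P n.
  (* The Bezout solution [s * m1], shifted by a multiple of [m] to become positive. *)
  pose w := s * m1 + m * (`|s * m1| + 1).
  have w0 : 0 < w by rewrite /w; nia.
  exists (absz w); apply/PE; rewrite gtz0_abs //; split=> //; left.
  apply/eqP; rewrite eqz_mod_dvd; apply/dvdzP.
  exists (m2 * (`|s * m1| + 1) - t * m1); rewrite /w.
  have : m1 * (s * m2 + t * m) = m1 by rewrite st mulr1.
  lia.
have [n /PE [n0 Pn] minn] := ex_minnP exP.
exists n%:Z; split=> // w w0 Pw.
have ew : (absz w)%:Z = w := gtz0_abs w0.
by rewrite -ew lez_nat; apply: minn; apply/PE; rewrite ew.
Qed.

(** Three independent signs occur, [e] for u, [f] for k and [g] for a; their product selects the
    branch of the lattice condition. *)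
Lemma markoff_congr_lattice m m1 m2 u k q a : markoff_congr m m1 m2 u ->
  (m %| k - u)%Z \/ (m %| k + u)%Z ->
  (m %| a - k * q)%Z \/ (m %| a + k * q)%Z -> markoff_lattice m m1 m2 a q.
Proof.
move=> hu hk ha.
have [e ee] : exists2 e : int, e = 1 \/ e = -1 & (m %| m2 * u - e * m1)%Z.
  case: hu => /eqP; rewrite eqz_mod_dvd => h.
    by exists 1; [left|rewrite mul1r].
  exists (-1); first by right.
  by rewrite -rpredN mulN1r opprK opprD -mulNr.
have [f ff] : exists2 f : int, f = 1 \/ f = -1 & (m %| k - f * u)%Z.
  by case: hk => h; [exists 1|exists (-1)]; rewrite ?mul1r ?mulN1r ?opprK; auto.
have [g gg] : exists2 g : int, g = 1 \/ g = -1 & (m %| a - g * (k * q))%Z.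
  by case: ha => h; [exists 1|exists (-1)]; rewrite ?mul1r ?mulN1r ?opprK; auto.
move=> /dvdzP[z hz] /dvdzP[y hy] /dvdzP[x hx].
have h : a * m2 - e * f * g * (q * m1) = (z * m2 + g * q * y * m2 + g * q * f * x) * m.
  have -> : a = z * m + g * (k * q) by rewrite -hz subrK.
  have -> : k = y * m + f * u by rewrite -hy subrK.
  have -> : e * f * g * (q * m1) = f * g * q * (e * m1) by ring.
  have -> : e * m1 = m2 * u - x * m by rewrite -hx subKr.
  ring.
case: ee ff gg h => -> [] -> [] ->; rewrite ?(mul1r, mulN1r, mulr1, mulrN1, opprK, mulNr) => h;
 by [left; apply/dvdzP; eexists; exact: h | right; apply/dvdzP; eexists; exact: h].
Qed.

(** * Real estimates for q below and above m *)

(** The equation gives [3 * X * e = 1 + e ^ 2 <= 5 / 4]. The point of the constant is that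
    [X * e + e < 1]. *)
Lemma small_root_bound (R : realFieldType) (X e : R) : 1 <= X -> 0 < e -> e <= 2^-1 ->
  e * (3 * X - e) = 1 -> 12 * (X * e) <= 5.
Proof. nra. Qed.

Lemma lattice_gap_low (R : realFieldType) (m m1 m2 q a : int) (e : R) :
  markoff_sol m m1 m2 -> 0 < e -> e <= 2^-1 -> e * (3 * m%:~R - e) = 1 ->
  0 < q -> q < m -> markoff_lattice m m1 m2 a q ->
  m%:~R * m%:~R * e < q%:~R * `|a%:~R + e * q%:~R|.
Proof.
move=> hs e0 e2 eE q0 qm hl; have [m0 _ _ _] := hs.
have X1 : 1 <= m%:~R :> R by rewrite ler1z -gtz0_ge1.
have Q1 : 1 <= q%:~R :> R by rewrite ler1z -gtz0_ge1.
have QX : q%:~R < m%:~R :> R by rewrite ltr_int.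
have bound b : markoff_lattice m m1 m2 b q -> 0 < b < m ->
    b%:~R * b%:~R + q%:~R * q%:~R + m%:~R * m%:~R <= 3 * m%:~R * b%:~R * q%:~R :> R.
  move=> hb b0; rewrite -!rmorphM -!rmorphD -[3]/(3%:~R) -!rmorphM ler_int.
  by apply: markoff_lattice_bound hs hb b0 _; rewrite q0.
have Xe := small_root_bound _ _ _ X1 e0 e2 eE.
set X : R := m%:~R in eE X1 QX bound Xe *; set Q : R := q%:~R in Q1 QX bound *.
have Qe : Q * e < X * e by rewrite ltr_pM2r.
have D0 : 0 < 3 * X - e by lra.
have XXe : X * X * e * (3 * X - e) = X * X by rewrite -mulrA eE mulr1.
have Xpos : 0 < X by lra.
have Xe1 : X * X * e < X * (1 - e) by rewrite -mulrA ltr_pM2l //; lra.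
have [a0|a0|a_eq0] := ltgtP a 0.
- have hl2 := markoff_lattice_opp _ _ _ _ _ hl.
  rewrite -normrN opprD -rmorphN /=.
  set B : R := (- a)%:~R.
  have B1 : 1 <= B by rewrite ler1z -gtz0_ge1 oppr_gt0.
  apply: (@lt_le_trans _ _ (Q * (B - e * Q))); last by rewrite ler_pM2l ?ler_norm //; lra.
  have [ma|am] := leP m (- a).
    have BX : X <= B by rewrite ler_int.
    apply: (lt_le_trans Xe1); nra.
  have := bound _ hl2; rewrite am oppr_gt0 a0 -/B => /(_ isT) h.
  (* The factor [3 * X - e] is the inverse of [e]. After multiplying by it the lattice bound cancels
     [Q * Q] and [X * X], and what remains follows from [e * Q < 1 <= B]. *)
  rewrite -(ltr_pM2r D0) XXe.
  rewrite (_ : Q * (B - e * Q) * (3 * X - e) =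
    3 * X * B * Q - e * B * Q - (Q * Q) * (e * (3 * X - e))); last by ring.
  rewrite eE; nra.
- rewrite ger0_norm; last by rewrite addr_ge0 ?mulr_ge0 ?ler0z //; lra || lia.
  set A : R := a%:~R.
  have A1 : 1 <= A by rewrite ler1z -gtz0_ge1.
  have [ma|am] := leP m a.
    have AX : X <= A by rewrite ler_int.
    nra.
  have := bound _ hl; rewrite a0 am -/A => /(_ isT) h.
  rewrite -(ltr_pM2r D0) XXe.
  rewrite (_ : Q * (A + e * Q) * (3 * X - e) =
    3 * X * A * Q - e * A * Q + (Q * Q) * (e * (3 * X - e))); last by ring.
  rewrite eE; nra.
(* For [a = 0] the lattice condition makes [q] a multiple of [m], contrary to [0 < q < m]. *)
move: (markoff_lattice_swap _ _ _ _ _ hs hl); rewrite a_eq0.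
move=> /(markoff_lattice_axis _ _ _ _ hs) /dvdzP [k hk].
have k0 : 0 < k by rewrite -(pmulr_lgt0 _ m0) -hk.
by move: qm; rewrite ltNge hk ler_peMl // -?gtz0_ge1 // ltW.
Qed.

(** Only negative [a] is delicate. The form at (q, - a) factors as [d * (d - Q * (3 * X - 2 * e))];
    were [Q * |d|] at most [X ^ 2 * e], its absolute value would fall below
    [X ^ 2 * e * (3 * X - e) = X ^ 2], against [markoff_form_min]. *)
Lemma lattice_gap_high (R : realFieldType) (m m1 m2 q a : int) (e : R) :
  markoff_sol m m1 m2 -> 0 < e -> e <= 2^-1 -> e * (3 * m%:~R - e) = 1 ->
  m < q -> markoff_lattice m m1 m2 a q ->
  m%:~R * m%:~R * e < q%:~R * `|a%:~R + e * q%:~R|.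
Proof.
move=> hs e0 e2 eE qm hl; have [m0 _ _ _] := hs.
have X1 : 1 <= m%:~R :> R by rewrite ler1z -gtz0_ge1.
have QX : m%:~R < q%:~R :> R by rewrite ltr_int.
have [a0|a0] := leP 0 a.
  have A0 : 0 <= a%:~R :> R by rewrite ler0z.
  rewrite ger0_norm; last by rewrite addr_ge0 ?mulr_ge0 //; lra.
  have h1 : m%:~R * m%:~R * e < q%:~R * q%:~R * e.
    by rewrite ltr_pM2r // ltr_pM //; lra.
  have h2 : 0 <= q%:~R * a%:~R :> R by rewrite mulr_ge0 //; lra.
  lra.
have [B aB] : exists B, a = - B by exists (- a); rewrite opprK.
subst a; have := markoff_lattice_opp _ _ _ _ _ hl; rewrite opprK.
move=> /(markoff_lattice_swap _ _ _ _ _ hs) hl2.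
have : (m * m)%:~R <= `|q * q + B * B - 3 * m * q * B|%:~R :> R.
  by rewrite ler_int; apply: markoff_form_min hs hl2 _ _ _; lia.
rewrite intr_norm rmorphB rmorphD !rmorphM rmorphN /=.
rewrite -[3%:~R]/(3 : R).
set X : R := m%:~R in eE X1 QX *; set Q : R := q%:~R in QX *; set b : R := B%:~R.
rewrite ltNge => hmin; apply/negP => hgap.
pose d := b - e * Q.
have eF : Q * Q + b * b - 3 * X * Q * b = d * (d - Q * (3 * X - 2 * e)).
  rewrite (_ : Q * Q = Q * Q * (e * (3 * X - e))); last by rewrite eE mulr1.
  by rewrite /d; ring.
have ed : `|- b + e * Q| = `|d| by rewrite -normrN /d opprD opprK.
rewrite {}ed in hgap; rewrite {}eF normrM in hmin.
have d0 : 0 <= `|d| by [].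
(* Strictness comes from [X < Q]. *)
have hd : `|d| < X * e.
  rewrite -(@ltr_pM2l _ Q); last lra.
  by apply: (le_lt_trans hgap); rewrite mulrA ltr_pM2r // ltr_pM2r //; lra.
have tri : `|d - Q * (3 * X - 2 * e)| <= `|d| + Q * (3 * X - 2 * e).
  by rewrite (le_trans (ler_normB _ _)) // lerD2l ger0_norm // mulr_ge0; lra.
move: hmin; apply/negP; rewrite -ltNge.
apply: (@le_lt_trans _ _ (`|d| * (`|d| + Q * (3 * X - 2 * e)))).
  by rewrite ler_wpM2l.
set D := `|d| in d0 hd hgap *.
have h1 : D * D < X * e * (X * e) by nra.
have h2 : (Q * D) * (3 * X - 2 * e) <= X * X * e * (3 * X - 2 * e).
  by rewrite ler_wpM2r //; lra.
have h3 : X * X * (e * (3 * X - e)) = X * X by rewrite eE mulr1.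
lra.
Qed.

(** * Roots of the form, distance to the integers, conclusion *)

Lemma root_times_m (R : realType) (m m1 m2 : int) (theta r e : R) :
  0 < m -> e * (3 * m%:~R - e) = 1 ->
  markoff_form m m1 m2 r 1 = 0 -> pm_equiv theta r ->
  exists2 k : int,
    (m %| k - markoff_u m m1 m2)%Z \/ (m %| k + markoff_u m m1 m2)%Z &
    m%:~R * theta = k%:~R + e \/ m%:~R * theta = k%:~R - e.
Proof.
move=> m0 eE; rewrite /markoff_form /markoff_v; set u := markoff_u m m1 m2.
set X : R := m%:~R in eE *; set U : R := u%:~R.
have X0 : X != 0 by rewrite intr_eq0 gt_eqF.
move=> hr heq.
(* Multiplying the form by [X] clears the denominator of v and splits it into these two factors, up
   to [e * (3 * X - e) - 1 = 0]. *)
have : (X * r - U + e) * (X * r - (U - 3 * X + e)) = 0.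
  rewrite expr1n !mulr1 in hr.
  rewrite (_ : _ * _ = X * (X * r ^+ 2 + (3 * X - 2 * U) * r +
    ((U ^+ 2 + 1) / X - 3 * U)) + (e * (3 * X - e) - 1)); last by field.
  by rewrite hr eE mulr0 add0r subrr.
have [n hn] : exists n : int, theta = r + n%:~R \/ theta = - r + n%:~R.
  by case: heq => /intrP [n hn]; exists n; [right|left]; rewrite -hn; ring.
move/eqP; rewrite mulf_eq0 => /orP[]; rewrite ?subr_eq0 ?addr_eq0 => /eqP hXr.
  have {}hXr : X * r = U - e by rewrite -[LHS](subrK U) hXr addrC.
  case: hn => ->; rewrite mulrDr ?mulrN hXr.
    exists (u + m * n); last by right; rewrite rmorphD rmorphM /= -/X -/U; ring.
    by left; rewrite addrAC subrr add0r dvdz_mulr.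
  exists (- u + m * n); last by left; rewrite rmorphD rmorphN rmorphM /= -/X -/U; ring.
  by right; rewrite addrAC addNr add0r dvdz_mulr.
case: hn => ->; rewrite mulrDr ?mulrN hXr.
  exists (u + m * (n - 3)); last first.
    by left; rewrite rmorphD rmorphM rmorphB /= -/X -/U; ring.
  by left; rewrite addrAC subrr add0r dvdz_mulr.
exists (- u + m * (n + 3)); last first.
  by right; rewrite rmorphD rmorphN rmorphM rmorphD /= -/X -/U; ring.
by right; rewrite addrAC addNr add0r dvdz_mulr.
Qed.

Lemma dist_int_near (R : realType) (x e : R) (k : int) : 0 <= e -> e <= 2^-1 ->
  x = k%:~R + e \/ x = k%:~R - e -> dist_int x = e.
Proof.
move=> e0 e2 hx; have [[p hp] le_p] := dist_int_min x.
apply/le_anti/andP; split.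
  apply: (le_trans (le_p k)).
  by case: hx => ->; rewrite addrAC subrr add0r ?normrN ger0_norm.
rewrite hp; case: (eqVneq p k) => [->|pk].
  by case: hx => ->; rewrite addrAC subrr add0r ?normrN ger0_norm.
have h : 1 <= `|(k - p)%:~R| :> R.
  by rewrite -intr_norm ler1z -gtz0_ge1 normr_gt0 subr_eq0 eq_sym.
have : `|(k - p)%:~R| <= `|x - p%:~R| + e.
  apply: (le_trans _ (_ : `|x - p%:~R| + `|x - k%:~R| <= _)); last first.
    by rewrite lerD2l; case: hx => ->; rewrite addrAC subrr add0r ?normrN ger0_norm.
  by rewrite rmorphB /= [leRHS]addrC [`|x - k%:~R|]distrC ler_distD.
lra.
Qed.

Theorem theorem3p1 (R : realType) (m m1 m2 : int) (theta : R)
  (Hm : markoff_triple m m1 m2)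
  (Htheta : exists r : R,
     markoff_form m m1 m2 r 1 = 0 /\ pm_equiv theta r) :
  m%:~R * dist_int (m%:~R * theta) = 2 / (3 + Num.sqrt (9 - 4 * m%:~R ^- 2)) /\
  (forall q : nat, (0 < q)%N -> q%:Z != m ->
     q%:R * dist_int (q%:R * theta) > m%:~R * dist_int (m%:~R * theta)).
Proof.
have hs : markoff_sol m m1 m2.
  by case: Hm => ? ? ? h; rewrite !expr2 in h; split=> //; lia.
have [m0 _ _ _] := hs; have [r [hr hth]] := Htheta.
pose X : R := m%:~R; pose s : R := Num.sqrt (9 - 4 * X ^- 2).
have X1 : 1 <= X by rewrite ler1z -gtz0_ge1.
have X0 : X != 0 by rewrite gt_eqF // (lt_le_trans ltr01).
have Y1 : X ^- 2 <= 1 by rewrite invf_le1 ?exprn_ege1 // exprn_gt0 // (lt_le_trans ltr01).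
have s2 : s ^+ 2 = 9 - 4 * X ^- 2 by rewrite sqr_sqrtr; lra.
have s0 : 0 <= s := sqrtr_ge0 _.
(* The smaller root of [e ^ 2 - 3 * X * e + 1], whose discriminant is [(X * s) ^ 2]. *)
pose e := X * (3 - s) / 2.
have XX : X * X * X ^- 2 = 1 by rewrite -expr2 divff // expf_neq0.
have eE : e * (3 * X - e) = 1.
  rewrite (_ : e * _ = X * X * (9 - s ^+ 2) / 4); last by rewrite /e; field.
  by rewrite s2 opprB addrC subrK mulrCA XX; field.
have s3 : s < 3.
  have : 0 < X ^- 2 by rewrite invr_gt0 exprn_gt0 // (lt_le_trans ltr01).
  rewrite expr2 in s2; nra.
have e0 : 0 < e by rewrite /e; apply: divr_gt0 => //; apply: mulr_gt0; lra.
have e2 : e <= 2^-1.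
  have XY : X * (X * X ^- 2) = 1 by rewrite mulrA XX.
  (* Since [(X * s) ^ 2 = 9 * X ^ 2 - 4], this amounts to [6 * X >= 5]. *)
  have hs1 : (3 * X - 1) ^+ 2 <= (X * s) ^+ 2.
    by rewrite exprMn s2 mulrBr mulrCA (expr2 X) XX; nra.
  have : 3 * X - 1 <= X * s by rewrite -ler_sqr ?nnegrE // ?mulr_ge0; lra.
  by rewrite /e; lra.
have [k hk hkt] := root_times_m _ _ _ _ _ _ _ m0 eE hr hth.
have dm : dist_int (X * theta) = e by apply: dist_int_near hkt => //; exact: ltW.
rewrite -/X dm; split.
  have d0 : 3 + s != 0 by rewrite gt_eqF //; lra.
  apply: (canRL (mulfK d0)).
  rewrite (_ : X * e * _ = X * X * (9 - s ^+ 2) / 2); last by rewrite /e; field.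
  by rewrite s2 opprB addrC subrK mulrCA XX; field.
move=> q q0 qm.
have [[p hp] _] := dist_int_min (q%:R * theta).
rewrite -(@ltr_pM2l _ X); last lra.
have gap a : (m %| a - k * q%:Z)%Z \/ (m %| a + k * q%:Z)%Z ->
   X * X * e < q%:~R * `|a%:~R + e * q%:~R|.
  move=> ha; have [_ hu _] := markoff_u_spec _ _ _ hs.
  have hl := markoff_congr_lattice _ _ _ _ _ _ _ hu hk ha.
  case: (ltgtP q%:Z m) qm => // qm _.
    exact: lattice_gap_low hs _ _ eE _ qm hl.
  exact: lattice_gap_high hs _ _ eE qm hl.
have [a ha ->] : exists2 a, (m %| a - k * q%:Z)%Z \/ (m %| a + k * q%:Z)%Z &
    X * (q%:R * dist_int (q%:R * theta)) = q%:~R * `|a%:~R + e * q%:~R|.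
  rewrite hp mulrCA.
  have XE : X * `|q%:R * theta - p%:~R| = `|q%:R * (X * theta) - X * p%:~R|.
    rewrite -{1}[X]ger0_norm; last lra.
    by rewrite -normrM; congr `|_|; ring.
  (* The sign of [a] is chosen so that [e] enters with coefficient [+ q] in both cases. *)
  rewrite XE; case: hkt => ->.
    exists (k * q%:Z - m * p); last by rewrite rmorphB !rmorphM /= -/X; congr (_ * `|_|); ring.
    by left; rewrite addrAC subrr add0r rpredN dvdz_mulr.
  exists (m * p - k * q%:Z).
    by right; rewrite subrK dvdz_mulr.
  by rewrite -normrN rmorphB !rmorphM /= -/X; congr (_ * `|_|); ring.
by rewrite mulrA; exact: gap.
Qed.
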